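(* Let $s,t,x$ be real numbers with $t\ge 0$. Then for every integer $k\ge 0$, $k!\,P_k(x,\,s^2t,\,0,\ldots,0)=H_k^{(s^2t)}(x)$, where $P_k$ is the $k$-th Kailath-Segall polynomial and $H_k^{(s^2t)}(x)$ is the generalized Hermite polynomial.
   Context: The Kailath-Segall polynomials $P_n(x_1,\ldots,x_n)$ in the indeterminates $x_1,x_2,\ldots$ are defined by $P_0=1$ and, for $n\ge 1$, by the recursion $P_n=\frac1n\left(P_{n-1}x_1-P_{n-2}x_2+\cdots+(-1)^{n+1}P_0x_n\right)$, where $P_j$ abbreviates $P_j(x_1,\ldots,x_j)$. Equivalently, as formal power series, $\sum_{n\ge 0}P_n(x_1,\ldots,x_n)z^n=\exp\left(\sum_{n\ge 1}\frac{(-1)^{n+1}}{n}x_nz^n\right)$. For $P_k(x,s^2t,0,\ldots,0)$ one substitutes $x_1=x$, $x_2=s^2t$ and $x_i=0$ for $i\ge 3$ (only the first $k$ of these values are used). For a real number $v$, the generalized Hermite polynomials $H_k^{(v)}(x)$ are defined by $\sum_{k\ge 0}H_k^{(v)}(x)\frac{z^k}{k!}=\exp\{xz-vz^2/2\}$. *)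

(* Defs.v *)
From HB Require Import structures.
From mathcomp Require Import all_boot all_order all_algebra reals.
From mathcomp Require Import mpoly.

Set Implicit Arguments.
Unset Strict Implicit.
Unset Printing Implicit Defensive.

Import Order.TTheory GRing.Theory Num.Theory.
Local Open Scope ring_scope.

Section KailathSegall.
Variables (R : fieldType) (N : nat).

(* Indices are shifted: [ks_var i] is the indeterminate x_(i+1). It is 0 for
   i >= N, a value that P_n never uses when n <= N. *)
Definition ks_var (i : nat) : {mpoly R[N]} :=
  if insub i is Some j then 'X_(j : 'I_N) else 0.

(* The list [:: P_0; ...; P_n]: the recursion for P_n uses all previous P_j. *)
Fixpoint ks_seq (n : nat) : seq {mpoly R[N]} :=
  if n is m.+1 then
    let s := ks_seq m in
    rcons s (m.+1%:R^-1 *: \sum_(i < m.+1) (-1) ^+ i * (s`_(m - i) * ks_var i))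
  else [:: 1].

(* P_n as an element of R[x_1, ..., x_N], meaningful for n <= N. *)
Definition ks_in (n : nat) : {mpoly R[N]} := (ks_seq n)`_n.

Lemma size_ks_seq n : size (ks_seq n) = n.+1.
Proof. by elim: n => //= n IHn; rewrite size_rcons IHn. Qed.

Lemma nth_ks_seq n j : (j <= n)%N -> (ks_seq n)`_j = ks_in j.
Proof.
elim: n => [|n IHn]; first by rewrite leqn0 => /eqP ->.
rewrite leq_eqVlt => /predU1P [-> //|]; rewrite ltnS => le_jn.
by rewrite /= nth_rcons size_ks_seq ltnS le_jn IHn.
Qed.

Lemma ks_in0 : ks_in 0 = 1.
Proof. by []. Qed.

Lemma ks_inS n :
  ks_in n.+1 =
    n.+1%:R^-1 *: \sum_(i < n.+1) (-1) ^+ i * (ks_in (n - i) * ks_var i).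
Proof.
rewrite {1}/ks_in /= nth_rcons size_ks_seq ltnn eqxx.
by congr (_ *: _); apply: eq_bigr => i _; rewrite nth_ks_seq ?leq_subr.
Qed.

End KailathSegall.

Definition kailath_segall (R : fieldType) (n : nat) : {mpoly R[n]} :=
  ks_in R n n.

(* The coefficient of z^n in the formal power series exp(f) = \sum_m f^m / m!,
   for f a polynomial in z with f(0) = 0: the terms with m > n have no
   coefficient of degree n, see [fexp_coefE]. *)
Definition fexp_coef (A : comUnitRingType) (f : {poly A}) (n : nat) : A :=
  (\sum_(m < n.+1) (m`!%:R : A)^-1 *: f ^+ m)`_n.

Lemma fexp_coefE (A : comUnitRingType) (f : {poly A}) (n M : nat) :
  f`_0 = 0 -> (n <= M)%N ->
  (\sum_(m < M.+1) (m`!%:R : A)^-1 *: f ^+ m)`_n = fexp_coef f n.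
Proof.
move=> f0; have coef_low m j : (j < m)%N -> (f ^+ m)`_j = 0.
  elim: m j => // m IHm j le_jm; rewrite exprS coefM big1 // => i _.
  case: (posnP i) => [->|i_gt0]; first by rewrite f0 mul0r.
  rewrite IHm ?mulr0 // (@leq_trans j) // ltn_subrL i_gt0 /=.
  by rewrite (leq_trans i_gt0) // -ltnS.
elim: M => [|M IHM]; first by rewrite leqn0 => /eqP ->.
rewrite leq_eqVlt => /predU1P [-> //|lt_nM].
by rewrite big_ord_recr /= coefD coefZ coef_low // mulr0 addr0 IHM.
Qed.

(* x z - v z^2 / 2 as a polynomial in z (the outer variable) with coefficients
   in R[x] (the inner variable). *)
Definition hermite_exponent (R : fieldType) (v : R) : {poly {poly R}} :=
  'X *: 'X - (v / 2%:R)%:P *: 'X^2.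

(* H_k^(v), i.e. \sum_k H_k^(v)(x) z^k / k! = exp (x z - v z^2 / 2) as formal
   power series in z over R[x]. *)
Definition hermite (R : fieldType) (v : R) (k : nat) : {poly R} :=
  k`!%:R *: fexp_coef (hermite_exponent v) k.

(* Main.v *)
(** Formal differentiation turns [E = exp f] into [E' = f' E], which for
    [f = sum_n (-1)^(n+1) x_n z^n / n] is the Kailath-Segall recursion; with
    [x_1 = x], [x_2 = v] and [x_n = 0] for [n > 2], this [f] is the Hermite
    exponent [x z - v z^2 / 2]. *)
Require Import Defs.
From HB Require Import structures.
From mathcomp Require Import all_boot all_order all_algebra reals.
From mathcomp Require Import mpoly.
Import Order.TTheory GRing.Theory Num.Theory.
Local Open Scope ring_scope.

Lemma fexp_coef0 (A : comUnitRingType) (f : {poly A}) : fexp_coef f 0 = 1.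
Proof.
by rewrite /fexp_coef big_ord1 fact0 invr1 scale1r expr0 coef1.
Qed.

(** Compare the coefficients of z^n in E' = f' E. *)
Lemma fexp_coefS (A : comUnitRingType) (f : {poly A}) (n : nat) :
    (forall m, (m.+1%:R : A) \is a GRing.unit) -> f`_0 = 0 ->
  n.+1%:R * fexp_coef f n.+1 = \sum_(i < n.+1) f^`()`_i * fexp_coef f (n - i).
Proof.
move=> unitS f0.
(* Truncation leaves no error term: the derivative of f^(m+1)/(m+1)! is f' f^m/m!, so the sum up to
   n+1 differentiates to f' times the sum up to n. *)
have deriv_series : (\sum_(m < n.+2) (m`!%:R : A)^-1 *: f ^+ m)^`()
    = f^`() * \sum_(m < n.+1) (m`!%:R : A)^-1 *: f ^+ m.
  rewrite big_ord_recl expr0 derivD derivZ derivC scaler0 add0r.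
  rewrite raddf_sum mulr_sumr; apply: eq_bigr => m _ /=.
  have unit_fact : (m`!%:R : A) \is a GRing.unit.
    by rewrite -(prednK (fact_gt0 m)).
  rewrite derivZ deriv_exp /= -scaler_nat scalerA /bump add1n factS.
  rewrite natrM invrM // -mulrA mulVr // mulr1.
  exact: scalerAr.
rewrite {1}/fexp_coef mulr_natl -coef_deriv deriv_series coefM.
by apply: eq_bigr => i _; rewrite fexp_coefE ?leq_subr.
Qed.

(** Since n+1 is invertible, the recursion determines each term from the earlier ones. As in
    [ks_var], [w i] is the value of x_(i+1). *)
Lemma meval_ks_in (R : numFieldType) (N : nat) (w c : nat -> R) :
    c 0%N = 1 ->
    (forall n, n.+1%:R * c n.+1 =
               \sum_(i < n.+1) (-1) ^+ i * (c (n - i)%N * w i)) ->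
  forall n, (n <= N)%N -> (ks_in R N n).@[fun i : 'I_N => w i] = c n.
Proof.
move=> c0 cS; elim/ltn_ind => -[_ _|n IHn lt_nN]; first by rewrite ks_in0 meval1.
have nz_n : n.+1%:R != 0 :> R by rewrite pnatr_eq0.
apply: (mulfI nz_n); rewrite cS ks_inS mevalZ mulVKf // raddf_sum.
apply: eq_bigr => i _ /=.
have lt_iN : (i < N)%N by apply: leq_trans lt_nN.
rewrite !mevalM rmorphXn rmorphN1 IHn ?ltnS ?leq_subr //; last first.
  by rewrite (leq_trans (leq_subr _ _)) // ltnW.
(* As i < N, the default 0 of [ks_var] does not occur. *)
rewrite /ks_var; case: insubP => [j _ <-|]; last by rewrite lt_iN.
by rewrite mevalXU.
Qed.

(** The derivative is x - v z. With the sign of the Kailath-Segall recursion taken out, its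
    coefficients are x_1 = x, x_2 = v and, through the default of [nth], x_n = 0 for n > 2. *)
Lemma coef_deriv_hermite_exponent (R : numFieldType) (v : R) (i : nat) :
  (hermite_exponent v)^`()`_i = (-1) ^+ i *: nth 0 [:: 'X; v%:P] i.
Proof.
rewrite /hermite_exponent derivB !derivE mul1r mulr1 coefB !coefZ coef1.
rewrite coefD coefX.
case: i => [|[|i]] /=.
- by rewrite addr0 mulr0 subr0 mulr1 scale1r.
- rewrite mulr0 sub0r expr1 scaleN1r -polyC1 -!polyCD -polyCM.
  by rewrite -mulr2n divfK // pnatr_eq0.
- by rewrite addr0 !mulr0 subr0 nth_nil scaler0.
Qed.

Lemma horner_fexp_coef_hermiteS (R : numFieldType) (v x : R) (n : nat) :
  n.+1%:R * (fexp_coef (hermite_exponent v) n.+1).[x] =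
  \sum_(i < n.+1) (-1) ^+ i *
    ((fexp_coef (hermite_exponent v) (n - i)).[x] * nth 0 [:: x; v] i).
Proof.
have unitS m : (m.+1%:R : {poly R}) \is a GRing.unit.
  by rewrite -polyC_natr rmorph_unit // unitfE pnatr_eq0.
have f0 : (hermite_exponent v)`_0 = 0.
  by rewrite /hermite_exponent coefB !coefZ coefX coefXn !mulr0 subr0.
(* Evaluation at x is a ring morphism, so it carries the identity from R[x] to R. *)
have := congr1 (horner_eval x) (fexp_coefS _ _ n unitS f0).
rewrite rmorphM rmorph_nat rmorph_sum => ->.
apply: eq_bigr => i _ /=; rewrite coef_deriv_hermite_exponent.
rewrite /horner_eval hornerM hornerZ -mulrA [_ * nth _ _ _]mulrC.
by case: i => -[|[|i]] lt_in; rewrite /= ?nth_nil ?hornerX ?hornerC.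
Qed.

Theorem mainTheorem1 (R : realType) (s t x : R) (ht : 0 <= t) (k : nat) :
  k`!%:R * (kailath_segall R k).@[fun i : 'I_k => nth 0 [:: x; s ^+ 2 * t] i]
  = (hermite (s ^+ 2 * t) k).[x].
Proof.
set v := s ^+ 2 * t.
rewrite /hermite hornerZ; congr (_ * _).
(* Both sides, freed of k!, start at 1 and obey the same recursion. *)
apply: (meval_ks_in _ _ _
  (fun n => (fexp_coef (hermite_exponent v) n).[x])) => //.
  by rewrite fexp_coef0 hornerC.
exact: horner_fexp_coef_hermiteS.
Qed.
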